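(* For every integer $d \geq 2$, there exists a critical value $\lambda_c(\mathbb{Z}^d) \in (0,\infty)$ such that, with $\vec e=(1,0,\ldots,0)\in\mathbb{Z}^d$ and $o$ the origin of $\mathbb{Z}^d$: (a) if $\lambda > \lambda_c(\mathbb{Z}^d)$, then $\mathbb{P}_{\lambda}(o\longleftrightarrow \vec{e}\,) < \mathbb{P}_{\lambda}(o\longleftrightarrow t\vec{e}\,)$ for all $t\in (0,1)$; (b) if $0 < \lambda < \lambda_c(\mathbb{Z}^d)$, then there exists $t = t(\lambda) \in (0,1)$ such that $\mathbb{P}_{\lambda}(o\longleftrightarrow \vec{e}\,) > \mathbb{P}_{\lambda}(o\longleftrightarrow t\vec{e}\,)$.
   Context: $\mathbb{Z}^d$ denotes the $d$-dimensional hypercubic lattice (nearest-neighbour graph), with edge set $\mathbb{E}=\mathbb{E}(\mathbb{Z}^d)$. The Pipe-Dust percolation model on $\mathbb{Z}^d$ with parameter $\lambda>0$ is defined as follows. For each edge $e$ with end-vertices $x,y$, let $I_e=\{x+t(y-x): t\in[0,1]\}\subset\mathbb{R}^d$ be the line segment joining its end-vertices. Independently on each segment $I_e$, $e\in\mathbb{E}$, put a Poisson point process of rate $\lambda$ (with respect to length); $\mathbb{P}_\lambda$ denotes the resulting product measure. Each point of the Poisson processes is called dust. For two points $x,y\in\bigcup_{e\in\mathbb{E}}I_e$, the event $\{x\longleftrightarrow y\}$ is the event that there exists a continuous path contained in $\bigcup_{e\in\mathbb{E}}I_e$ connecting $x$ to $y$ and avoiding all dust. *)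

(* Defs.v *)
From mathcomp Require Export all_boot all_order all_algebra.
From mathcomp Require Export finmap.
From mathcomp Require Export all_classical all_reals all_analysis.

Set Implicit Arguments.
Unset Strict Implicit.
Unset Printing Implicit Defensive.

Export Order.TTheory GRing.Theory Num.Theory.
Export numFieldNormedType.Exports.

Local Open Scope classical_set_scope.
Local Open Scope ring_scope.

Definition mutually_independent (disp : measure_display)
    (Omega : measurableType disp) (R : realType) (P : probability Omega R)
    (I : choiceType) (F : I -> set_system Omega) : Prop :=
  forall (J : {fset I}) (A : I -> set Omega),
    (forall i, i \in J -> F i (A i)) ->
    P (\bigcap_(i in [set` J]) A i) = (\prod_(i <- J) P (A i))%E.

Section PoissonProcess.
Context {disp : measure_display} {Omega : measurableType disp} {R : realType}.
Implicit Types (P : probability Omega R) (D : Omega -> set R) (B : set R).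

(* [fset_set] sends an infinite set to [fset0], so this is the number of points
   of [D w] in [B] only when that number is finite; [poisson_process] imposes
   the finiteness. *)
Definition point_count D B (w : Omega) : nat := #|` fset_set (D w `&` B)|%fset.

(* A homogeneous Poisson point process on the unit interval, as a random finite
   set of points. The second argument of the library's [poisson_prob] is unused;
   at rate 0 [poisson_prob] is the Dirac mass at 0. *)
Definition poisson_process P (rate : R) D : Prop :=
  [/\ forall w, finite_set (D w) /\ D w `<=` `[0, 1],
      forall B, measurable B -> measurable_fun setT (point_count D B),
      forall B, measurable B -> B `<=` `[0, 1] -> forall U : set nat,
        P (point_count D B @^-1` U) =
          poisson_prob (rate * fine (lebesgue_measure B)) 0%N U
    & forall (n : nat) (B : 'I_n -> set R),
        (forall i, measurable (B i)) -> trivIset setT B ->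
        mutually_independent P
          (fun i => g_sigma_algebra_preimage (point_count D (B i)))].

Definition process_sigma_algebra D : set_system Omega :=
  <<s \bigcup_(B in measurable) g_sigma_algebra_preimage (point_count D B) >>.

End PoissonProcess.

Section PipeDust.
Context {R : realType} {d : nat}.

(* [(x, i)] stands for the unordered pair of vertices [{x, x + e_i}], with [e_i]
   the [i]-th basis vector; every nearest-neighbour edge of Z^d is of this form
   for exactly one [(x, i)]. *)
Definition edge : Type := ('rV[int]_d * 'I_d)%type.

Definition edge_point (e : edge) (s : R) : 'rV[R]_d :=
  map_mx intr e.1 + s *: delta_mx 0 e.2.

Definition edge_segment (e : edge) : set 'rV[R]_d := edge_point e @` `[0, 1].

Definition pipes : set 'rV[R]_d := \bigcup_e edge_segment e.

(* A dust configuration is given edge by edge through the arc-length parameter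
   of [edge_point]. *)
Definition dust_points (D : edge -> set R) : set 'rV[R]_d :=
  \bigcup_e (edge_point e @` D e).

Definition dust_connected (D : edge -> set R) (x y : 'rV[R]_d) : Prop :=
  exists gamma : R -> 'rV[R]_d,
    [/\ {within `[0, 1], continuous gamma}, gamma 0 = x, gamma 1 = y,
        gamma @` `[0, 1] `<=` pipes
      & gamma @` `[0, 1] `&` dust_points D = set0].

(* [dust] realises the law P_lambda: independent Poisson point processes of rate
   [lambda], one on each edge. *)
Definition pipe_dust (disp : measure_display) (Omega : measurableType disp)
    (P : probability Omega R) (lambda : R) (dust : edge -> Omega -> set R)
    : Prop :=
  (forall e, poisson_process P lambda (dust e)) /\
  mutually_independent P (fun e => process_sigma_algebra (dust e)).

Definition connection_event (Omega : Type) (dust : edge -> Omega -> set R)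
    (x y : 'rV[R]_d) : set Omega :=
  [set w | dust_connected (dust ^~ w) x y].

Definition first_basis_vector : 'rV[R]_d := \row_(i < d) (i == 0 :> nat)%:R.

End PipeDust.

Arguments edge d : clear implicits.
Arguments first_basis_vector R d : clear implicits.

(* Main.v *)
(** The probability of [o <-> t e] is [x + (y - p) q], where [p = exp(-lambda)],
    [x = exp(-lambda t)], [y = exp(-lambda (1 - t))] and [q] is the probability
    that bond percolation of parameter [p] joins [o] to [e] without the edge
    [oe]; at [t = 1] the probability is [p + (1 - p) q].  The difference of the
    two is [(1 - y) (x - q)], and [x] ranges over [(p, 1)], so (a) amounts to
    [q <= p] and (b) to [q > p].  The Moore-Shannon inequality (the odds of [q]
    over the odds of [p] are nondecreasing in [p]) shows that [{p | q(p) <= p}]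
    is an initial segment of [(0, 1)]; a union bound over edges at [o] and at
    [e] shows that it is nonempty, and two disjoint detours of length 3 show
    that it does not contain 9/10.  Passing to the increasing limits over finite
    edge sets, only polynomials in [p] are needed. *)
Require Import Defs.
From mathcomp Require Import measurable_realfun ring lra zify.

Set Implicit Arguments.
Unset Strict Implicit.
Unset Printing Implicit Defensive.

Local Open Scope classical_set_scope.
Local Open Scope ring_scope.

(** * Finite percolation and the Moore-Shannon inequality *)

Section PercolationExpectation.
Context {R : realType} {E : eqType}.
Implicit Types (p : R) (g : seq E -> R) (s A O : seq E).

(* Expectation of [g] at the union of [A] and a random subset of [s] to which
   every entry of [s] belongs independently with probability [p]. *)
Fixpoint perc_ex p g s A : R :=
  if s is e :: s' then p * perc_ex p g s' (e :: A) + (1 - p) * perc_ex p g s' A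
  else g A.

Lemma perc_ex_cst p c s A : perc_ex p (fun=> c) s A = c.
Proof. by elim: s A => //= e s IH A; rewrite !IH; ring. Qed.

Lemma perc_exD p g h s A :
  perc_ex p (g \+ h) s A = perc_ex p g s A + perc_ex p h s A.
Proof. by elim: s A => //= e s IH A; rewrite !IH; ring. Qed.

Lemma perc_exB p g h s A :
  perc_ex p (g \- h) s A = perc_ex p g s A - perc_ex p h s A.
Proof. by elim: s A => //= e s IH A; rewrite !IH; ring. Qed.

Lemma perc_ex_sum p (I : Type) (r : seq I) (P : pred I) (G : I -> seq E -> R)
    s A :
  perc_ex p (fun O => \sum_(i <- r | P i) G i O) s A =
  \sum_(i <- r | P i) perc_ex p (G i) s A.
Proof.
elim: s A => //= e s IH A.
by rewrite !IH !mulr_sumr -big_split.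
Qed.

Lemma ler_perc_ex p g h s A : 0 <= p <= 1 -> (forall O, g O <= h O) ->
  perc_ex p g s A <= perc_ex p h s A.
Proof.
move=> /andP[p0 p1] gh; elim: s A => //= e s IH A.
by apply: lerD; rewrite ler_wpM2l ?subr_ge0.
Qed.

Lemma perc_ex_ge0 p g s A : 0 <= p <= 1 -> (forall O, 0 <= g O) ->
  0 <= perc_ex p g s A.
Proof. by move=> p01 g0; rewrite -(perc_ex_cst p 0 s A) ler_perc_ex. Qed.

Lemma perc_ex_le1 p g s A : 0 <= p <= 1 -> (forall O, g O <= 1) ->
  perc_ex p g s A <= 1.
Proof. by move=> p01 g0; rewrite -(perc_ex_cst p 1 s A) ler_perc_ex. Qed.

Lemma perc_ex_mono p g s A A' : 0 <= p <= 1 ->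
  (forall O O', {subset O <= O'} -> g O <= g O') -> {subset A <= A'} ->
  perc_ex p g s A <= perc_ex p g s A'.
Proof.
move=> /andP[p0 p1] gm; elim: s A A' => [|e s IH] A A' AA' /=; first exact: gm.
apply: lerD; rewrite ler_wpM2l ?subr_ge0// IH//.
by move=> x; rewrite !inE => /orP[->//|/AA' ->]; rewrite orbT.
Qed.

Lemma perc_ex_subset p s A (T : seq E) : uniq s -> uniq T -> ~~ has (mem A) s ->
  perc_ex p (fun O => (all (mem O) T)%:R) s A =
  if all (mem (s ++ A)) T then p ^+ count (predC (mem A)) T else 0.
Proof.
move=> + uT; elim: s A => [|e s IH] A /=.
  move=> _ _; case: ifP => // TA.
  rewrite (_ : count _ _ = 0%N) ?expr0//; apply/eqP.
  by rewrite -leqn0 leqNgt -has_count has_predC TA.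
move=> /andP[es us] /norP[eA sA].
have sub (B : seq E) : (forall x, (x \in e :: s ++ A) = (x \in B)) ->
    all (mem (e :: s ++ A)) T = all (mem B) T.
  by move=> h; apply: eq_all => x /=; exact: h.
have hasA : has (mem (e :: A)) s = false.
  apply/negbTE/hasPn => x xs /=; rewrite inE negb_or (hasPn sA)// andbT.
  by apply: contraNneq es => <-.
rewrite !IH ?hasA//.
rewrite -[RHS]/(if all (mem (e :: s ++ A)) T then _ else _).
rewrite (sub (s ++ e :: A)); last first.
  by move=> x; rewrite !(inE, mem_cat); case: (x \in s); rewrite ?orbT.
case: (boolP (e \in T)) => eT; last first.
  have cT : count (predC (mem (e :: A))) T = count (predC (mem A)) T.
    apply: eq_in_count => x xT /=; rewrite inE.
    by case: eqP => // xe; rewrite xe in xT; rewrite xT in eT.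
  have -> : all (mem (s ++ A)) T = all (mem (s ++ e :: A)) T.
    apply: eq_in_all => x xT /=; rewrite !mem_cat inE.
    by case: eqP => // xe; rewrite xe in xT; rewrite xT in eT.
  by rewrite cT; case: ifP => _; ring.
have -> : all (mem (s ++ A)) T = false.
  apply/negbTE/allPn; exists e => //=; rewrite mem_cat negb_or es.
  exact: eA.
rewrite mulr0 addr0; case: ifP => _; last by rewrite mulr0.
rewrite -exprS; congr (_ ^+ _).
have -> : count (predC (mem A)) T =
    (count (pred1 e) T + count (predC (mem (e :: A))) T)%N.
  rewrite -count_predUI (@eq_count _ (predI _ _) pred0); last first.
    by move=> x /=; rewrite inE; case: eqP.
  rewrite count_pred0 addn0; apply: eq_count => x /=; rewrite inE.
  by case: eqP => [->|].
by rewrite count_uniq_mem// eT.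
Qed.

Lemma moore_shannon_step p p' a0 a1 b0 b1 :
  0 < p -> p <= p' -> p' < 1 ->
  0 <= a0 -> a0 <= a1 -> a1 <= 1 -> 
  a0 * (1 - b0) * (p' * (1 - p)) <= b0 * (1 - a0) * (p * (1 - p')) ->
  a1 * (1 - b1) * (p' * (1 - p)) <= b1 * (1 - a1) * (p * (1 - p')) ->
  (p * a1 + (1 - p) * a0) * (1 - (p' * b1 + (1 - p') * b0)) *
    (p' * (1 - p)) <=
  (p' * b1 + (1 - p') * b0) * (1 - (p * a1 + (1 - p) * a0)) *
    (p * (1 - p')).
Proof.
move=> p0 pp' p'1 a00 a01 a11 h0 h1.
set a := p * a1 + _; set b := p' * b1 + _.
pose u := p' * (1 - p); pose v := p * (1 - p').
have v0 : 0 < v by rewrite mulr_gt0// subr_gt0.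
have uv : 0 <= u - v by rewrite (_ : u - v = p' - p) ?subr_ge0// /u /v; ring.
have D0 : 0 < v + (u - v) * a0 by rewrite ltr_wpDr// mulr_ge0.
have D1 : 0 < v + (u - v) * a1.
  by rewrite ltr_wpDr// mulr_ge0//; exact: le_trans a01.
rewrite -subr_ge0 in h0; rewrite -subr_ge0 in h1; rewrite -subr_ge0.
(* The hypotheses read [ai * u <= bi * (v + (u - v) * ai)]; clear the
   denominators [v + (u - v) * ai]. *)
rewrite -(pmulr_rge0 _ (mulr_gt0 D0 D1)).
set e0 := (X in 0 <= X) in h0; set e1 := (X in 0 <= X) in h1.
have -> : (v + (u - v) * a0) * (v + (u - v) * a1) *
    (b * (1 - a) * (p * (1 - p')) - a * (1 - b) * (p' * (1 - p))) =
  u * (v * (a1 - a0)) * ((u - v) * (v * (1 - a1) + u * a0)) +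
  (p * (v + (u - v) * a1) + (1 - p) * (v + (u - v) * a0)) *
  (p' * (v + (u - v) * a0) * e1 + (1 - p') * (v + (u - v) * a1) * e0).
  by rewrite /e0 /e1 /u /v /a /b; ring.
have u0 : 0 <= u by lra.
have p'0 : 0 <= p' by lra.
have q0 : 0 <= 1 - p by lra.
have q'0 : 0 <= 1 - p' by lra.
have a10 : 0 <= a1 - a0 by lra.
have a1' : 0 <= 1 - a1 by lra.
have := (ltW v0, ltW p0, ltW D0, ltW D1) => -[[[v0' p0'] D0'] D1'].
by do ![assumption | apply: mulr_ge0 | apply: addr_ge0].
Qed.

(* In terms of odds: the odds ratio of [h(p')] to [h(p)] is at least that of
   [p'] to [p]. *)
Lemma moore_shannon p p' (f : seq E -> bool) s A
    (h := fun x : R => perc_ex x (fun O => (f O)%:R) s A) :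
  0 < p -> p <= p' -> p' < 1 ->
  (forall O O', {subset O <= O'} -> f O -> f O') ->
  h p * (1 - h p') * (p' * (1 - p)) <= h p' * (1 - h p) * (p * (1 - p')).
Proof.
move=> p0 pp' p'1 fm; rewrite {}/h; elim: s A => /= [|e s IH] A.
  by case: (f A); rewrite ?subrr ?mulr0 ?mul0r.
have p01 : 0 <= p <= 1 by apply/andP; split; lra.
apply: moore_shannon_step => //.
- by apply: perc_ex_ge0.
- apply: perc_ex_mono => // [ O O' OO'|x xA]; last by rewrite inE xA orbT.
  have := fm _ _ OO'; case: (f O) => [/(_ isT) ->|_]; first exact: lexx.
  by case: (f O'); rewrite ?lexx ?ler01.
- by apply: perc_ex_le1 => // O; rewrite lern1 leq_b1.
Qed.

Lemma perc_ex_le_param p p' (f : seq E -> bool) s A :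
  0 < p -> p <= p' -> p' < 1 ->
  (forall O O', {subset O <= O'} -> f O -> f O') ->
  perc_ex p' (fun O => (f O)%:R) s A <= p' ->
  perc_ex p (fun O => (f O)%:R) s A <= p.
Proof.
move=> p0 pp' p'1 fm; have := moore_shannon s A p0 pp' p'1 fm => /=.
have p01 : 0 <= p <= 1 by apply/andP; split; lra.
have : perc_ex p (fun O => (f O)%:R) s A <= 1.
  by apply: perc_ex_le1 => // O; rewrite lern1 leq_b1.
have : 0 <= perc_ex p (fun O => (f O)%:R) s A.
  by apply: perc_ex_ge0.
set a := perc_ex _ _ _ _; set b := perc_ex _ _ _ _ => a0 a1 h bp.
have h1 : b * (1 - a) * (p * (1 - p')) <= p' * (1 - a) * (p * (1 - p')).
  apply: ler_wpM2r; first by apply: mulr_ge0; lra.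
  by apply: ler_wpM2r; lra.
have h2 : a * (1 - p') * (p' * (1 - p)) <= a * (1 - b) * (p' * (1 - p)).
  apply: ler_wpM2r; first by apply: mulr_ge0; lra.
  by apply: ler_wpM2l; lra.
have c0 : 0 < p' * (1 - p') by apply: mulr_gt0; lra.
have : 0 <= p' * (1 - p') * (p - a).
  have -> : p' * (1 - p') * (p - a) = p' * (1 - a) * (p * (1 - p')) -
    a * (1 - p') * (p' * (1 - p)) by ring.
  rewrite subr_ge0; exact: le_trans (le_trans h2 h) h1.
by rewrite pmulr_rge0// subr_ge0.
Qed.

End PercolationExpectation.

(** * Lattice paths and the critical parameter *)

Section Reach.
Context {d : nat}.
Implicit Types (x y z : 'rV[int]_d) (i j : 'I_d) (e : edge d).

Inductive reach (O : edge d -> Prop) x : 'rV[int]_d -> Prop :=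
| reach_refl : reach O x x
| reach_forward y i : reach O x y -> O (y, i) -> reach O x (y + delta_mx 0 i)
| reach_backward y i : reach O x (y + delta_mx 0 i) -> O (y, i) -> reach O x y.

Definition incident_edges x : seq (edge d) :=
  [seq (x, i) | i <- enum 'I_d] ++ [seq (x - delta_mx 0 i, i) | i <- enum 'I_d].

Lemma incident_edge_source x i : (x, i) \in incident_edges x.
Proof. by rewrite mem_cat map_f ?mem_enum. Qed.

Lemma incident_edge_target x i : (x, i) \in incident_edges (x + delta_mx 0 i).
Proof.
rewrite mem_cat; apply/orP; right; apply/mapP; exists i; rewrite ?mem_enum//.
by rewrite addrK.
Qed.

Lemma size_incident_edges x : size (incident_edges x) = d.*2.
Proof.
rewrite size_cat (size_map (fun i => (x, i))).
by rewrite (size_map (fun i => (x - delta_mx 0 i, i))) size_enum_ord addnn.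
Qed.

Lemma sub_reach (O O' : edge d -> Prop) x y :
  (forall e, O e -> O' e) -> reach O x y -> reach O' x y.
Proof.
move=> OO'; elim=> [|{}y i _ IH /OO'|{}y i _ IH /OO'].
- exact: reach_refl.
- exact: reach_forward.
- exact: reach_backward.
Qed.

Lemma reach_finite (O : edge d -> Prop) x y : reach O x y ->
  exists s : seq (edge d),
    (forall e, e \in s -> O e) /\ reach (fun e => e \in s) x y.
Proof.
have ext (s : seq (edge d)) e y' : reach (fun e' => e' \in s) x y' ->
    reach (fun e' => e' \in e :: s) x y'.
  by move=> xy'; apply: sub_reach xy' => e'; rewrite inE orbC => ->.
elim=> [|{}y i _ [s [sO xy]] Oe|{}y i _ [s [sO xy]] Oe].
- by exists [::]; split=> //; exact: reach_refl.
- exists ((y, i) :: s); split.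
    by move=> e; rewrite inE => /predU1P[->|/sO].
  by apply: reach_forward; [exact (ext s (y, i) _ xy)|exact: mem_head].
- exists ((y, i) :: s); split.
    by move=> e; rewrite inE => /predU1P[->|/sO].
  by apply: reach_backward; [exact (ext s (y, i) _ xy)|exact: mem_head].
Qed.

Lemma reach_last_edge (O : edge d -> Prop) x y : reach O x y -> y != x ->
  exists2 e, e \in incident_edges y & O e.
Proof.
case=> [|{}y i _ Oe _|{}y i _ Oe _]; first by rewrite eqxx.
- by exists (y, i) => //; exact: incident_edge_target.
- by exists (y, i) => //; exact: incident_edge_source.
Qed.

Lemma reach_first_edge (O : edge d -> Prop) x y : reach O x y -> y != x ->
  exists2 e, e \in incident_edges x & O e.
Proof.
elim=> [|{}y i _ IH Oe _|{}y i _ IH Oe yx]; first by rewrite eqxx.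
- have [yx|/IH//] := eqVneq y x.
  by exists (y, i) => //; rewrite -yx; exact: incident_edge_source.
- have [yx'|/IH//] := eqVneq (y + delta_mx 0 i) x.
  by exists (y, i) => //; rewrite -yx'; exact: incident_edge_target.
Qed.

End Reach.

Section AltConnected.
Context {R : realType} {d : nat} (i0 i1 : 'I_d) (i10 : i1 != i0).

Definition base_edge : edge d := (0, i0).

Definition alt_connected (O : seq (edge d)) : bool :=
  `[< reach (fun e => e \in O /\ e != base_edge) 0 (delta_mx 0 i0) >].

Lemma alt_connected_mono O O' : {subset O <= O'} ->
  alt_connected O -> alt_connected O'.
Proof.
move=> OO' /asboolP OE; apply/asboolP; apply: sub_reach OE => e [eO ee0].
by split=> //; exact: OO'.
Qed.

Lemma delta_mx_neq0 i : delta_mx 0 i != 0 :> 'rV[int]_d.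
Proof. by apply/eqP => /matrixP/(_ 0 i); rewrite !mxE !eqxx. Qed.

Lemma delta_mx_inj i j : delta_mx 0 i = delta_mx 0 j :> 'rV[int]_d -> i = j.
Proof.
move=> /matrixP/(_ 0 i); rewrite !mxE !eqxx /=.
by case: eqP.
Qed.

Lemma incident_both e : e \in incident_edges 0 ->
  e \in incident_edges (delta_mx 0 i0) -> e = base_edge.
Proof.
rewrite !mem_cat => /orP[] /mapP[i _ ->] /orP[] /mapP[j _ []].
- by move/esym/eqP; rewrite (negbTE (delta_mx_neq0 _)).
- move=> + ij; subst j => /esym/eqP; rewrite subr_eq0 => /eqP/delta_mx_inj.
  by move=> <-.
- move=> + ij; subst j; rewrite sub0r => /matrixP/(_ 0 i0).
  by rewrite !mxE !eqxx; case: (i0 == i).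
- move=> + ij; subst j => /addIr/esym/eqP.
  by rewrite (negbTE (delta_mx_neq0 _)).
Qed.

Lemma alt_connected_two_edges O : alt_connected O ->
  exists a b, [/\ a \in incident_edges 0, b \in incident_edges (delta_mx 0 i0),
    a != base_edge, b != base_edge & all (mem O) [:: a; b]].
Proof.
move=> /asboolP OE; have n0 := delta_mx_neq0 i0.
have [a ainc [aO a0]] := reach_first_edge OE n0.
have [b binc [bO b0]] := reach_last_edge OE n0.
by exists a, b; split=> //=; rewrite aO bO.
Qed.

Local Notation q p s :=
  (perc_ex p (fun O => (alt_connected O)%:R) s [::]).

Lemma perc_alt_connected_small (p : R) s : 0 <= p <= 1 -> uniq s ->
  q p s <= (d.*2 * d.*2)%:R * p ^+ 2.
Proof.
move=> p01 us; have /andP[p0 p1] := p01.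
pose ne := predC1 base_edge.
pose pairs := [seq (a, b) | a <- incident_edges (0 : 'rV[int]_d),
                            b <- incident_edges (delta_mx 0 i0)].
pose G (ab : edge d * edge d) (O : seq (edge d)) : R :=
  (all (mem O) [:: ab.1; ab.2])%:R.
pose c (ab : edge d * edge d) := ne ab.1 && ne ab.2.
apply: (@le_trans _ _ (perc_ex p (fun O => \sum_(ab <- pairs | c ab) G ab O)
    s [::])).
  apply: ler_perc_ex => // O; have [|_] := boolP (alt_connected O); last first.
    by apply: sumr_ge0 => ab _; exact: ler0n.
  move=> /alt_connected_two_edges[a [b [ai bi an bn abO]]].
  have abp : (a, b) \in pairs by apply: allpairs_f.
  rewrite (big_rem _ abp) /= /c /= /ne /= an bn /= {1}/G abO lerDl.
  by apply: sumr_ge0 => ab _; exact: ler0n.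
rewrite perc_ex_sum big_seq_cond.
apply: (@le_trans _ _ (\sum_(ab <- pairs | (ab \in pairs) && c ab) p ^+ 2)).
  apply: ler_sum => -[a b] /andP[/allpairsP[[a' b'] /= [ai bi [? ?]]]]; subst.
  move=> /andP[/= an bn]; rewrite perc_ex_subset//=.
  - by case: ifP => //= _; rewrite exprn_ge0.
  - rewrite inE andbT; apply: contraNneq an => ab.
    by apply/eqP/incident_both => //; rewrite ab.
  - by apply/hasPn => x.
rewrite big_const_seq iter_addr addr0 -[leLHS]mulr_natl ler_wpM2r ?exprn_ge0//.
rewrite ler_nat (leq_trans (count_size _ _))//.
by rewrite size_allpairs !size_incident_edges.
Qed.

Let upper_path : seq (edge d) :=
  [:: (0, i1); (delta_mx 0 i1, i0); (delta_mx 0 i0, i1)].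
Let lower_path : seq (edge d) :=
  [:: (- delta_mx 0 i1, i1); (- delta_mx 0 i1, i0);
      (delta_mx 0 i0 - delta_mx 0 i1, i1)].

Let uniq_paths : uniq (upper_path ++ lower_path).
Proof.
apply: (@map_uniq _ _ (fun e : edge d => (e.1 0 i0, e.1 0 i1, e.2 == i0))).
by rewrite /= !mxE !eqxx (negbTE i10) eq_sym (negbTE i10).
Qed.

Lemma alt_connected_upper_path O : all (mem O) upper_path -> alt_connected O.
Proof.
move=> /= /and4P[h1 h2 h3 _]; apply/asboolP.
have ne1 (x : 'rV[int]_d) : (x, i1) != base_edge.
  by apply/eqP => -[_ /eqP]; rewrite (negbTE i10).
apply: (@reach_backward _ _ _ _ i1); last by split.
rewrite addrC; apply: reach_forward; last first.
  by split=> //; apply/eqP => -[/eqP]; rewrite (negbTE (delta_mx_neq0 _)).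
rewrite -[delta_mx 0 i1]add0r; apply: reach_forward; last by split.
exact: reach_refl.
Qed.

Lemma alt_connected_lower_path O : all (mem O) lower_path -> alt_connected O.
Proof.
move=> /= /and4P[h1 h2 h3 _]; apply/asboolP.
have ne1 (x : 'rV[int]_d) : (x, i1) != base_edge.
  by apply/eqP => -[_ /eqP]; rewrite (negbTE i10).
rewrite -[X in reach _ _ X](subrK (delta_mx 0 i1)).
apply: reach_forward; last by split.
rewrite addrC; apply: reach_forward; last first.
  split=> //; apply/eqP => -[/eqP]; rewrite oppr_eq0.
  by rewrite (negbTE (delta_mx_neq0 _)).
apply: (@reach_backward _ _ _ _ i1); last by split.
rewrite addNr; exact: reach_refl.
Qed.

Lemma perc_alt_connected_large :
  exists2 s, uniq s & 9 / 10 < q (9 / 10 : R) s.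
Proof.
exists (upper_path ++ lower_path) => //.
pose I (T O : seq (edge d)) : R := (all (mem O) T)%:R.
have p01 : 0 <= (9 / 10 : R) <= 1 by apply/andP; split; lra.
have hI T : subseq T (upper_path ++ lower_path) ->
    perc_ex (9 / 10 : R) (I T) (upper_path ++ lower_path) [::] =
    (9 / 10) ^+ size T.
  move=> Tsub; rewrite perc_ex_subset//.
  - have -> : all (mem ((upper_path ++ lower_path) ++ [::])) T.
      by rewrite cats0; apply/allP => e; exact: (mem_subseq Tsub).
    by congr (_ ^+ _); apply/eqP; rewrite -all_count; apply/allP.
  - exact: subseq_uniq Tsub _.
apply: (@lt_le_trans _ _ (perc_ex (9 / 10)
   ((I upper_path \+ I lower_path) \- I (upper_path ++ lower_path))
   (upper_path ++ lower_path) [::])).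
  rewrite perc_exB perc_exD !hI ?prefix_subseq ?suffix_subseq//=; lra.
apply: ler_perc_ex => // O.
rewrite -[X in X <= _]/(I upper_path O + I lower_path O
  - I (upper_path ++ lower_path) O) /I all_cat.
have := @alt_connected_upper_path O; have := @alt_connected_lower_path O.
case: (all (mem O) upper_path) => [_ /(_ isT) ->|].
  by case: (all (mem O) lower_path); rewrite /=; lra.
case: (all (mem O) lower_path) => [/(_ isT) -> _|_ _].
  by rewrite /=; lra.
by case: (alt_connected O); rewrite /=; lra.
Qed.

Lemma critical_parameter : exists2 pc : R, 0 < pc < 1 &
  (forall p, 0 < p < pc -> forall s, uniq s -> q p s <= p) /\
  (forall p, pc < p < 1 -> exists2 s, uniq s & p < q p s).
Proof.
pose S : set R := [set p | 0 < p < 1 /\ forall s, uniq s -> q p s <= p].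
have Sdown p p' : 0 < p <= p' -> S p' -> S p.
  move=> /andP[p0 pp'] [/andP[_ p'1] Sp']; split.
    by rewrite p0 (le_lt_trans pp').
  move=> s us; apply: (perc_ex_le_param p0 pp' p'1 alt_connected_mono).
  exact: Sp'.
have ub p : S p -> p <= 9 / 10.
  move=> Sp; rewrite leNgt; apply/negP => plt.
  have [|_ h] := @Sdown (9 / 10) p _ Sp; first by rewrite ltW// andbT; lra.
  by have [s /h] := perc_alt_connected_large; rewrite leNgt => /negbTE ->.
have dpos : (0 < d)%N by case: d i0 => // -[].
pose N : R := (d.*2 * d.*2)%:R.
have N2 : 4 <= N.
  by rewrite (ler_nat R 4) (@leq_mul 2 2) ?(leq_double 1).
have N0 : 0 < N by lra.
have SN : S N^-1.
  split; first by rewrite invr_gt0 N0 invf_lt1//; lra.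
  move=> s us; rewrite (le_trans (perc_alt_connected_small _ us))//.
    by rewrite invr_ge0 ltW//= invf_le1//; lra.
  by rewrite expr2 mulrA divff ?mul1r// gt_eqF.
have hsS : has_sup S by split; [exists N^-1|exists (9 / 10)].
exists (sup S).
  apply/andP; split.
    by rewrite (@lt_le_trans _ _ N^-1) ?invr_gt0// ub_le_sup//; case: hsS.
  by rewrite (@le_lt_trans _ _ (9 / 10))//; [apply: ge_sup; case: hsS|lra].
split=> p /andP[h1 h2].
  have [|p' Sp' pp'] := sup_adherent (_ : 0 < sup S - p) hsS.
    by rewrite subr_gt0.
  rewrite subKr in pp'; apply: (@Sdown p p' _ Sp').2.
  by rewrite h1 ltW.
apply: contrapT => np; suff /(ub_le_sup hsS.2) : S p by rewrite leNgt h1.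
have S0 : 0 < sup S.
  by rewrite (@lt_le_trans _ _ N^-1) ?invr_gt0// ub_le_sup//; case: hsS.
split=> [|s us]; first by rewrite h2 (lt_trans _ h1).
by rewrite leNgt; apply/negP => plt; apply: np; exists s.
Qed.

End AltConnected.

(** * Paths in the pipes *)

Lemma connected_locally_constant (T : topologicalType) (A : set T)
    (P : T -> Prop) (x : T) :
  connected A -> A x -> P x ->
  (forall z, A z -> \forall z' \near z, A z' -> (P z <-> P z')) ->
  forall z, A z -> P z.
Proof.
move=> cA Ax Px loc.
suff -> : A = A `&` P by move=> z [].
apply/esym/cA; first by exists x.
- exists (interior [set z | A z -> P z]); first exact: open_interior.
  rewrite eqEsubset; split=> z [Az Pz]; split=> //.
    apply: filterS (loc z Az) => z' h Az'; exact: (h Az').1.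
  exact: (interior_subset Pz).
- exists (~` interior [set z | A z -> ~ P z]).
    exact/open_closedC/open_interior.
  rewrite eqEsubset; split=> z [Az Pz]; split=> //.
    by move=> /interior_subset /(_ Az).
  apply: contrapT => nPz; apply: Pz.
  by apply: filterS (loc z Az) => z' h Az' Pz'; apply/nPz/(h Az').2.
Qed.

Section Geometry.
Context {R : realType} {d : nat}.
Implicit Types (e : edge d) (s t u : R) (x y v : 'rV[int]_d) (z : 'rV[R]_d).

Definition vertex x : 'rV[R]_d := map_mx intr x.

Lemma edge_pointE e s j :
  edge_point e s 0 j = (e.1 0 j)%:~R + s * (j == e.2)%:R.
Proof. by rewrite !mxE eqxx. Qed.

Lemma edge_point0 e : edge_point e 0 = vertex e.1.
Proof. by rewrite /edge_point scale0r addr0. Qed.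

Lemma edge_point1 e : edge_point e 1 = vertex (e.1 + delta_mx 0 e.2).
Proof.
apply/matrixP => i j; rewrite ord1 edge_pointE !mxE eqxx /= mul1r intrD.
by case: (j == e.2).
Qed.

Lemma intr_close (a b : int) : `|a%:~R - b%:~R : R| < 1 -> a = b.
Proof.
rewrite -intrB -intr_norm -[1]/(1%:~R) ltr_int => h; lia.
Qed.

Lemma edge_point_inj e e' s s' : 0 < s < 1 -> 0 <= s' <= 1 ->
  edge_point e s = edge_point e' s' -> e = e' /\ s = s'.
Proof.
case: e e' => [x i] [x' i'] /andP[s0 s1] /andP[s'0 s'1] /matrixP E.
have Ej j : (x 0 j)%:~R + s * (j == i)%:R = (x' 0 j)%:~R + s' * (j == i')%:R.
  by have := E 0 j; rewrite !edge_pointE.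
have ii' : i = i'.
  apply/eqP/negPn/negP => ii'; have := Ej i.
  rewrite eqxx (negbTE ii') mulr1 mulr0 addr0 => h.
  have xx' : x 0 i = x' 0 i.
    by apply: intr_close; rewrite ltr_norml; apply/andP; split; lra.
  by rewrite xx' in h; lra.
subst i'; have := Ej i; rewrite eqxx !mulr1 => h.
have xi : x 0 i = x' 0 i.
  by apply: intr_close; rewrite ltr_norml; apply/andP; split; lra.
have ss' : s = s' by rewrite xi in h; lra.
split=> //; congr (_, _); apply/matrixP => k j; rewrite ord1.
have := Ej j; rewrite ss' => /addIr h'; apply: intr_close.
by rewrite h' subrr normr0.
Qed.

Lemma vertex_inj : injective vertex.
Proof.
move=> x y /matrixP xy; apply/matrixP => i j; apply: intr_close.
by have := xy i j; rewrite !mxE => ->; rewrite subrr normr0.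
Qed.

Lemma edge_point_vertex e s v : 0 <= s <= 1 -> edge_point e s = vertex v ->
  (s = 0 /\ v = e.1) \/ (s = 1 /\ v = e.1 + delta_mx 0 e.2).
Proof.
move=> /andP[s0 s1] es.
have [s00|sn0] := eqVneq s 0.
  by left; split=> //; apply: vertex_inj; rewrite -es s00 edge_point0.
have [s11|sn1] := eqVneq s 1.
  by right; split=> //; apply: vertex_inj; rewrite -es s11 edge_point1.
have : edge_point e s = edge_point (v, e.2) 0 by rewrite es edge_point0.
case/edge_point_inj => [||_ s00].
- by rewrite !lt_neqAle s0 s1 eq_sym sn0 sn1.
- by rewrite lexx ler01.
- by rewrite s00 eqxx in sn0.
Qed.

Lemma edge_point_continuous e : continuous (edge_point e : R -> 'rV[R]_d).
Proof.
move=> s; apply: cvgD; first exact: cvg_cst.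
by apply: cvgZr_tmp; exact: cvg_id.
Qed.

Lemma closed_edge_point_image e (B : set R) : closed B -> B `<=` `[0, 1] ->
  closed (edge_point e @` B).
Proof.
move=> cB B01; apply: compact_closed; first exact: norm_hausdorff.
apply: continuous_compact.
  exact/continuous_subspaceT/edge_point_continuous.
by apply: subclosed_compact B01 => //; exact: segment_compact.
Qed.

Lemma finite_edges_near z :
  finite_set [set e : edge d |
    exists2 s, 0 <= s <= 1 & ball z 1 (edge_point e s)].
Proof.
pose F (k : {ffun 'I_d -> 'I_6} * 'I_d) : edge d :=
  (\row_j (Num.floor (z 0 j) - 2 + (k.1 j)%:Z), k.2).
apply: (@sub_finite_set _ _ (F @` setT)); last exact/finite_image/finite_finset.
move=> e [s /andP[s0 s1] [_ be]].
have h j : 0 <= e.1 0 j - Num.floor (z 0 j) + 2 < 6.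
  have := be 0 j; rewrite edge_pointE /ball /= ltr_norml => /andP[h1 h2].
  have /andP[h3 h4] := floor_itv (z 0 j).
  have /andP[h5 h6] : 0 <= s * (j == e.2)%:R <= 1.
    by case: (j == e.2); rewrite ?mulr1 ?mulr0 ?s0 ?s1 ?lexx ?ler01.
  rewrite intrD in h4.
  have h7 : (e.1 0 j)%:~R < (Num.floor (z 0 j) + 2)%:~R :> R.
    by rewrite intrD; lra.
  have h8 : (Num.floor (z 0 j) - 2)%:~R < (e.1 0 j)%:~R :> R.
    by rewrite intrB; lra.
  by move: h7 h8; rewrite !ltr_int => *; apply/andP; split; lia.
exists ([ffun j : 'I_d => inord (absz (e.1 0 j - Num.floor (z 0 j) + 2))],
  e.2) => //.
rewrite /F /=; case: e h {be} => x i /= h; congr (_, _).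
apply/matrixP => k j; rewrite ord1 mxE ffunE /=.
have := h j; set m := Num.floor _ => hj.
rewrite inordK; lia.
Qed.

Section Dust.
Variable D : edge d -> set R.

Definition clear_segment e s t : Prop :=
  forall u, s <= u <= t -> ~ dust_points D (edge_point e u).

Definition segment_linked z z' : Prop :=
  exists e s s', [/\ 0 <= s <= 1, 0 <= s' <= 1, z = edge_point e s,
    z' = edge_point e s' &
    forall u, (s <= u <= s') || (s' <= u <= s) ->
      ~ dust_points D (edge_point e u)].

Inductive linked z : 'rV[R]_d -> Prop :=
| linked_refl : linked z z
| linked_step z1 z2 : linked z z1 -> segment_linked z1 z2 -> linked z z2.

Lemma segment_linked_sym z z' : segment_linked z z' -> segment_linked z' z.
Proof.
move=> [e [s [s' [h1 h2 h3 h4 h5]]]]; exists e, s', s; split=> // u.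
by rewrite orbC; exact: h5.
Qed.

Lemma clear_segment_linked e s t : 0 <= s -> s <= t -> t <= 1 ->
  clear_segment e s t -> segment_linked (edge_point e s) (edge_point e t).
Proof.
move=> s0 st t1 cl; exists e, s, t; split=> //.
- by rewrite s0 (le_trans st).
- by rewrite t1 (le_trans s0).
- by move=> u /orP[/cl//|/andP[tu us]]; apply: cl; apply/andP; split; lra.
Qed.

Lemma linked_reach x z : linked (vertex x) z -> z = vertex x \/
  exists2 v, reach (fun e => clear_segment e 0 1) x v &
    segment_linked (vertex v) z.
Proof.
elim=> [|z1 z2 _ IH z12]; first by left.
right; case: IH => [z1x|[v xv vz1]].
  by exists x; [exact: reach_refl|rewrite -z1x].
have [e [s [s1 [s01 s101 ves z1e cl]]]] := vz1.
have [e' [s1' [s2 [s1'01 s201 z1e' z2e cl']]]] := z12.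
have [s1int|s1int] := boolP (0 < s1 < 1).
  have [ee' ss'] := edge_point_inj s1int s1'01 (etrans (esym z1e) z1e').
  subst e' s1'; exists v => //; exists e, s, s2; split=> // u h.
  have [us1|us1] := leP u s1.
    have [su|us] := leP s u; first by apply: cl; rewrite su us1.
    by apply: cl'; apply/orP; right; rewrite us1; case/orP: h => /andP[]; lra.
  have [su|us] := ltP s u; last by apply: cl; rewrite (ltW us1) us orbT.
  apply: cl'; apply/orP; left; rewrite (ltW us1).
  by case/orP: h => /andP[]; lra.
have {s1int} s1end : s1 = 0 \/ s1 = 1.
  move: s1int; rewrite negb_and -!leNgt => /orP[]; lra.
have [[s0 ve]|[sE1 ve]] := edge_point_vertex s01 (esym ves).
- case: s1end => s1E.
    by exists v => //; rewrite ves s0 -s1E -z1e.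
  exists (v + delta_mx 0 e.2); last by rewrite ve -edge_point1 -s1E -z1e.
  apply: reach_forward => //; rewrite ve => u u01.
  case: (e) ve cl => x' i' ve cl; apply: cl; rewrite s0 s1E u01//.
- case: s1end => s1E; last first.
    by exists v => //; rewrite ves sE1 -s1E -z1e.
  exists e.1; last by rewrite -edge_point0 -s1E -z1e.
  apply: (@reach_backward _ _ _ _ e.2); first by rewrite -ve.
  move=> u u01.
  by case: (e) ve cl => x' i' ve cl; apply: cl; rewrite sE1 s1E u01 orbT.
Qed.

Lemma reach_linked x v : reach (fun e => clear_segment e 0 1) x v ->
  linked (vertex x) (vertex v).
Proof.
have eSt y i : clear_segment (y, i) 0 1 ->
    segment_linked (vertex y) (vertex (y + delta_mx 0 i)).
  rewrite -(edge_point0 (y, i)) -(edge_point1 (y, i)).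
  by apply: clear_segment_linked; rewrite ?lexx ?ler01.
elim=> [|y i _ IH /eSt h|y i _ IH /eSt h]; first exact: linked_refl.
- exact: linked_step h.
- exact: linked_step (segment_linked_sym h).
Qed.

Lemma linked_vertex x v : x != v -> linked (vertex x) (vertex v) <->
  reach (fun e => clear_segment e 0 1) x v.
Proof.
move=> xv; split; last exact: reach_linked.
move=> /linked_reach[/vertex_inj/esym/eqP|]; first by rewrite (negbTE xv).
move=> [y xy [e [s [s' [s01 s'01 yes ves' cl]]]]].
have [[s0 ye]|[s1 ye]] := edge_point_vertex s01 (esym yes);
have [[s'0 ve]|[s'1 ve]] := edge_point_vertex s'01 (esym ves').
- by rewrite ve -ye.
- rewrite ve; apply: reach_forward; first by rewrite -ye.
  by case: (e) cl => a b cl u u01; apply: cl; rewrite s0 s'1 u01.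
- rewrite ve; apply: (@reach_backward _ _ _ _ e.2); first by rewrite -ye.
  by case: (e) cl => a b cl u u01; apply: cl; rewrite s1 s'0 u01 orbT.
- by rewrite ve -ye.
Qed.

Lemma linked_interior i t : 0 < t < 1 ->
  linked (vertex 0) (edge_point (0, i) t) <->
  clear_segment (0, i) 0 t \/
  clear_segment (0, i) t 1 /\
    reach (fun e => clear_segment e 0 1) 0 (delta_mx 0 i).
Proof.
move=> t01; have /andP[t0 t1] := t01.
have t01' : 0 <= t <= 1 by rewrite !ltW.
split; last first.
  case=> [h|[h /reach_linked r]].
    apply: linked_step; first exact: linked_refl.
    rewrite -(edge_point0 (0, i)).
    by apply: clear_segment_linked => //; exact: ltW.
  apply: linked_step r _; apply: segment_linked_sym.
  rewrite -[delta_mx 0 i]add0r -(edge_point1 (0, i)).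
  by apply: clear_segment_linked => //; exact: ltW.
move=> /linked_reach[/(edge_point_vertex t01')[[tE _]|[tE _]]|].
- by move: t0; rewrite tE ltxx.
- by move: t1; rewrite tE ltxx.
move=> [y xy [e [s [s' [s01 s'01 yes tes' cl]]]]].
have [ee ts'] := edge_point_inj t01 s'01 tes'; subst e s'.
have [[s0 ye]|[s1 ye]] := edge_point_vertex s01 (esym yes).
  by left => u u01; apply: cl; rewrite s0 u01.
right; split; first by move=> u u01; apply: cl; rewrite s1 u01 orbT.
by move: ye; rewrite /= add0r => <-.
Qed.

Hypothesis finD : forall e, finite_set (D e) /\ D e `<=` `[0, 1].

Lemma near_edges_and_dust z : ~ dust_points D z ->
  \forall z' \near z, ~ dust_points D z' /\
    forall e s', 0 <= s' <= 1 -> z' = edge_point e s' -> edge_segment e z.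
Proof.
move=> nz.
pose F := [set e : edge d | exists2 s, 0 <= s <= 1 & ball z 1 (edge_point e s)].
pose K := \bigcup_(e in F) (edge_point e @` D e `|`
  (if `[< edge_segment e z >] then set0 else edge_segment e)).
have cK : closed K.
  apply: closed_bigcup; first exact: finite_edges_near.
  move=> e _; apply: closedU.
    apply: closed_edge_point_image; last exact: (finD e).2.
    apply: compact_closed; first exact: Rhausdorff.
    exact/finite_compact/(finD e).1.
  case: ifP => _; first exact: closed0.
  by apply: closed_edge_point_image => //; exact: itv_closed.
have nKz : (~` K) z.
  move=> [e _ [[s Ds esz]|]]; first by apply: nz; exists e => //; exists s.
  by case: asboolP.
have : nbhs z (~` K) by apply: open_nbhs_nbhs; split=> //; exact: closed_openC.
move=> nK; have := nbhsx_ballx z 1 ltr01 => nB.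
apply: filterS2 nK nB => z' nKz' bz'; split.
  move=> [e _ [s Ds esz']]; apply: nKz'; exists e; last by left; exists s.
  by exists s; [have := (finD e).2 s Ds; rewrite /= in_itv|rewrite esz'].
move=> e s' s'01 z'e; apply: contrapT => nez; apply: nKz'; exists e.
  by exists s' => //; rewrite -z'e.
by right; case: asboolP => // _; exists s'.
Qed.

Lemma near_segment_linked z : ~ dust_points D z ->
  \forall z' \near z, pipes z' -> segment_linked z z'.
Proof.
move=> /near_edges_and_dust/nbhs_ballP[r /= r0 br].
apply/nbhs_ballP; exists r => //= z' bz' [e _ [s' s'01 z'e]].
have s'01' : 0 <= s' <= 1 by move: s'01; rewrite /= in_itv.
have [_ /(_ _ _ s'01' (esym z'e)) [s s01 ze]] := br _ bz'.
have s01' : 0 <= s <= 1 by move: s01; rewrite /= in_itv.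
exists e, s, s'; split=> // u us.
have [] := br (edge_point e u) => //.
move: bz'; rewrite -ze -z'e => -[_ bz']; split=> // k j.
have := bz' k e.2; rewrite !ord1 /ball /= !edge_pointE eqxx !mulr1.
rewrite !ltr_norml => /andP[h1 h2].
by case: (j == e.2); rewrite ?mulr1 ?mulr0;
   case/orP: us => /andP[h3 h4]; apply/andP; split; lra.
Qed.

Lemma dust_connected_linked z z' : dust_connected D z z' -> linked z z'.
Proof.
move=> [gamma [cg g0 g1 gp gd]].
have nd w : (gamma @` `[0, 1]) w -> ~ dust_points D w.
  by move=> gw dw; have : set0 w by rewrite -gd; split.
have mem0 : `[0, 1]%classic (0 : R) by rewrite /= in_itv /= lexx ler01.
have mem1 : `[0, 1]%classic (1 : R) by rewrite /= in_itv /= lexx ler01.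
apply: (@connected_locally_constant _ (gamma @` `[0, 1]) (linked z) z).
- by apply: connected_continuous_connected => //; exact: segment_connected.
- by exists 0.
- exact: linked_refl.
- move=> y gy; apply: filterS (near_segment_linked (nd y gy)) => y' h gy'.
  have yy' := h (gp _ gy'); split=> [zy|zy']; first exact: linked_step yy'.
  exact: linked_step (segment_linked_sym yy').
- by exists 1.
Qed.

Lemma linked_dust_connected z z' : pipes z -> ~ dust_points D z ->
  linked z z' -> dust_connected D z z'.
Proof.
move=> pz nz zz'.
suff [a [gamma [a0 cg g0 ga gp]]] : exists (a : R) (gamma : R -> 'rV[R]_d),
    [/\ 0 <= a, continuous gamma, gamma 0 = z,
      forall r, a <= r -> gamma r = z' &
      forall r, 0 <= r -> (pipes `\` dust_points D) (gamma r)].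
  exists (fun r => gamma (r * a)); split.
  - apply: continuous_subspaceT => r; apply: continuous_comp; last exact: cg.
    exact: mulrr_continuous.
  - by rewrite mul0r.
  - by rewrite mul1r ga.
  - move=> y [r]; rewrite /= in_itv /= => /andP[r0 _] <-.
    by have [] := gp (r * a) (mulr_ge0 r0 a0).
  - rewrite -subset0 => y [[r]]; rewrite /= in_itv /= => /andP[r0 _] <-.
    by have [] := gp (r * a) (mulr_ge0 r0 a0).
elim: zz' => [|z1 z2 _ [a [gamma [a0 cg g0 ga gp]]]].
  by exists 0, (fun=> z); split=> //; exact: cst_continuous.
move=> [e [s [s' [s01 s'01 z1e z2e cl]]]].
pose c r : R := Num.min 1 (Num.max 0 (r - a)).
have cc : continuous c.
  move=> r; apply: (@continuous_min _ _ (fun=> 1) (fun r => Num.max 0 (r - a))).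
    exact: cst_continuous.
  apply: (@continuous_max _ _ (fun=> 0) (fun r => r - a)).
    exact: cst_continuous.
  by apply: cvgB; [exact: cvg_id|exact: cvg_cst].
have cle r : r <= a -> c r = 0.
  by move=> ra; rewrite /c max_l ?subr_le0// min_r.
have c01 r : 0 <= c r <= 1.
  by rewrite /c le_min ler01 le_max lexx /= ge_min lexx.
(* Adding the increment along the new segment, instead of gluing two paths,
   keeps the path continuous on all of [R]. *)
pose gamma' r := gamma r + (edge_point e (s + c r * (s' - s)) - z1).
have g'a r : a <= r -> gamma' r = edge_point e (s + c r * (s' - s)).
  by move=> ar; rewrite /gamma' ga// addrC subrK.
exists (a + 1), gamma'; split.
- by rewrite addr_ge0.
- move=> r; apply: cvgD; first exact: cg.
  apply: cvgB; last exact: cvg_cst.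
  apply: (@continuous_comp _ _ _ (fun r => s + c r * (s' - s))); last first.
    exact: edge_point_continuous.
  apply: cvgD; first exact: cvg_cst.
  by apply: cvgM; [exact: cc|exact: cvg_cst].
- by rewrite /gamma' g0 cle// mul0r addr0 -z1e subrr addr0.
- move=> r ar; rewrite g'a; last by lra.
  by rewrite (_ : c r = 1) ?mul1r ?subrKC// /c max_r ?min_l//; lra.
- move=> r r0; have [ar|ra] := leP a r; last first.
    by rewrite /gamma' cle ?ltW// mul0r addr0 -z1e subrr addr0; exact: gp.
  rewrite g'a//; set u := s + _.
  have us : (s <= u <= s') || (s' <= u <= s).
    have /andP[c0 c1] := c01 r; rewrite /u; apply/orP.
    have [ss'|ss'] := leP s s'; [left|right]; apply/andP; split; nra.
  split; last exact: cl.
  by exists e => //; exists u => //=; rewrite in_itv /=; case/orP: us; lra.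
Qed.

Lemma dust_connectedP z z' : pipes z ->
  dust_connected D z z' <-> ~ dust_points D z /\ linked z z'.
Proof.
move=> pz; split=> [c|[nz]]; last exact: linked_dust_connected.
split; last exact: dust_connected_linked.
move: c => [gamma [_ g0 _ _ gd]] dz.
suff : set0 z by [].
by rewrite -gd; split=> //; exists 0 => //=; rewrite in_itv /= lexx ler01.
Qed.

End Dust.
End Geometry.

(** * Independence *)

Section RealProbability.
Context {disp : measure_display} {Omega : measurableType disp} {R : realType}.
Variable P : probability Omega R.
Implicit Types A B : set Omega.

Definition pr A : R := fine (P A).

Lemma prE A : measurable A -> P A = (pr A)%:E.
Proof. by move=> mA; rewrite fineK// fin_num_measure. Qed.

Lemma pr_setT : pr setT = 1.
Proof. by rewrite /pr probability_setT. Qed.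

Lemma pr_set0 : pr set0 = 0.
Proof. by rewrite /pr measure0. Qed.

Lemma pr_setDI A B : measurable A -> measurable B ->
  pr A = pr (A `\` B) + pr (A `&` B).
Proof.
move=> mA mB; apply/EFin_inj.
by rewrite EFinD -!prE ?(measureDI P mA mB)//;
  [exact: measurableI|exact: measurableD].
Qed.

Lemma pr_le A B : measurable A -> measurable B -> A `<=` B -> pr A <= pr B.
Proof. by move=> mA mB AB; rewrite -lee_fin -!prE// le_measure ?inE. Qed.

Lemma pr_setU A B : measurable A -> measurable B ->
  pr (A `|` B) = pr A + pr B - pr (A `&` B).
Proof.
move=> mA mB; rewrite (pr_setDI (measurableU _ _ mA mB) mA).
rewrite setDUl setDv set0U setUK (pr_setDI mB mA) (setIC B); ring.
Qed.

Lemma pr_eq_off_null A B N : measurable A -> measurable B -> P.-negligible N ->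
  A `\` N = B `\` N -> pr A = pr B.
Proof.
move=> mA mB [N' [mN' N'0 NN']] AB.
have h C : measurable C -> pr C = pr (C `\` N').
  move=> mC; rewrite (pr_setDI mC mN') [X in _ + X](_ : _ = 0) ?addr0//.
  rewrite /pr (@subset_measure0 _ _ _ P _ N')//; exact: measurableI.
rewrite (h A)// (h B)//; congr pr.
by rewrite -(setUidr NN') -!setDDl AB.
Qed.

Section Independence.
Context {I : choiceType} (F : I -> set_system Omega).
Hypothesis Findep : mutually_independent P F.
Hypothesis Fmeas : forall i, F i `<=` measurable.

Definition cylinder_off (s : seq I) (X : set Omega) : Prop :=
  exists (J : {fset I}) (A : I -> set Omega),
    [/\ forall i, i \in J -> F i (A i), forall i, i \in s -> i \notin J &
        X = \bigcap_(i in [set` J]) A i].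

Lemma cylinder_off_setT s : cylinder_off s setT.
Proof.
by exists fset0, (fun=> setT); split=> //; rewrite set_fset0 bigcap_set0.
Qed.

Lemma cylinder_off_measurable s X : cylinder_off s X -> measurable X.
Proof.
move=> [J [A [FA _ ->]]]; apply: fin_bigcap_measurable => //.
by move=> i /= /FA /Fmeas.
Qed.

Lemma cylinder_off_setI i s X B : i \notin s -> cylinder_off (i :: s) X ->
  F i B -> cylinder_off s (X `&` B) /\ pr (X `&` B) = pr X * pr B.
Proof.
move=> si cX FB; have mX := cylinder_off_measurable cX.
case: cX => J [A [FA sJ XE]].
have iJ : i \notin J by rewrite sJ ?mem_head.
pose A' j := if j == i then B else A j.
have A'J j : j \in J -> A' j = A j.
  by rewrite /A'; case: eqP => // ->; rewrite (negbTE iJ).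
have FA' j : j \in (i |` J)%fset -> F j (A' j).
  rewrite in_fset1U => /predU1P[->|jJ]; first by rewrite /A' eqxx.
  by rewrite A'J//; exact: FA.
have XB : X `&` B = \bigcap_(j in [set` (i |` J)%fset]) A' j.
  rewrite set_fsetU1 bigcap_setU1 /A' eqxx setIC XE; congr (_ `&` _).
  by apply: eq_bigcapr => j /= /A'J; rewrite /A' => ->.
split.
  exists (i |` J)%fset, A'; split=> // j js; rewrite in_fset1U negb_or.
  by rewrite sJ ?inE ?js ?orbT// andbT; apply: contraNneq si => <-.
apply: EFin_inj; rewrite EFinM -!prE//; last 2 first.
- exact: Fmeas FB.
- by apply: measurableI => //; exact: Fmeas FB.
rewrite XB Findep// big_fsetU1//= {1}/A' eqxx muleC; congr (_ * _)%E.
rewrite XE Findep//; apply: eq_big_seq => j /A'J -> //.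
Qed.

Context {p : R} (O : I -> set Omega).
Hypothesis FO : forall i, F i (O i) /\ F i (~` O i).
Hypothesis prO : forall i, pr (O i) = p.

Fixpoint open_seq (w : Omega) (s a : seq I) : seq I :=
  if s is e :: s' then open_seq w s' (if w \in O e then e :: a else a) else a.

Lemma mem_open_seq w s a i :
  i \in open_seq w s a = (i \in a) || (i \in s) && (w \in O i).
Proof.
elim: s a => [|e s IH] a /=; first by rewrite orbF.
rewrite IH inE; have [->|ie] /= := eqVneq i e.
  by case: ifP => wO; rewrite ?inE ?eqxx ?orbT ?andbF ?orbF.
by case: ifP => wO; rewrite ?inE ?(negbTE ie).
Qed.

Lemma open_seq_event (f : seq I -> bool) e s a :
  [set w | f (open_seq w (e :: s) a)] =
  (O e `&` [set w | f (open_seq w s (e :: a))]) `|`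
  (~` O e `&` [set w | f (open_seq w s a)]).
Proof.
apply/seteqP; split=> w /=; have [wO|wO] := pselect (O e w).
- by rewrite (mem_set wO) => h; left.
- by rewrite (memNset wO) => h; right.
- by rewrite (mem_set wO) => -[[]|[]].
- by rewrite (memNset wO) => -[[]|[]].
Qed.

Lemma measurable_open_seq (f : seq I -> bool) s a :
  measurable [set w | f (open_seq w s a)].
Proof.
elim: s a => [|e s IH] a.
  rewrite /=; case: (f a).
    by rewrite (_ : [set _ | _] = setT); [exact: measurableT|apply/seteqP].
  by rewrite (_ : [set _ | _] = set0)//; apply/seteqP; split.
rewrite open_seq_event; apply: measurableU; apply: measurableI => //.
- exact: Fmeas (FO e).1.
- exact: Fmeas (FO e).2.
Qed.

Lemma pr_open_seq (f : seq I -> bool) s a X : uniq s -> cylinder_off s X ->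
  pr (X `&` [set w | f (open_seq w s a)]) =
  pr X * perc_ex p (fun b => (f b)%:R) s a.
Proof.
elim: s a X => [|e s IH] a X /=.
  move=> _ _; case: (f a).
    by rewrite mulr1 (_ : [set _ | _] = setT) ?setIT//; apply/seteqP.
  rewrite mulr0 (_ : [set _ | _] = set0) ?setI0 /pr ?measure0//.
  by apply/seteqP; split.
move=> /andP[es us] cX.
have mX := cylinder_off_measurable cX.
have mO := Fmeas (FO e).1.
have mOC := Fmeas (FO e).2.
have mF b : measurable [set w | f (open_seq w s b)].
  exact: measurable_open_seq.
have [c1 p1] := cylinder_off_setI es cX (FO e).1.
have [c0 p0] := cylinder_off_setI es cX (FO e).2.
have pC : pr (~` O e) = 1 - p.
  have := pr_setDI measurableT mO; rewrite setTD setTI prO pr_setT => ->; ring.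
have := @open_seq_event f e s a; rewrite /= => ->.
rewrite setIUr pr_setU; last 2 first.
- by do 2 apply: measurableI => //.
- by do 2 apply: measurableI => //.
rewrite [X in _ - pr X](_ : _ = set0); last first.
  by apply/seteqP; split=> w //= [[_ [h _]] [_ [h' _]]].
rewrite !setIA !IH// p1 p0 prO pC pr_set0; ring.
Qed.

End Independence.
End RealProbability.

(** * Percolation outside the base edge *)

Section PipeDustEvents.
Context {R : realType} {d : nat} (i0 : 'I_d).
Context {disp : measure_display} {Omega : measurableType disp}.
Variables (P : probability Omega R) (lambda : R).
Variable dust : edge d -> Omega -> set R.
Hypothesis lambda_gt0 : 0 < lambda.
Hypothesis Pdust : pipe_dust P lambda dust.

Implicit Types (e : edge d) (B : set R) (s : seq (edge d)).
Local Notation pr := (pr P).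

Let F e := process_sigma_algebra (dust e).
Let e0 := base_edge i0.

Let finD w e : finite_set (dust e w) /\ dust e w `<=` `[0, 1].
Proof. by have [+ _ _ _] := Pdust.1 e; apply. Qed.

Definition no_dust e (B : set R) : set Omega := [set w | dust e w `&` B = set0].

Lemma no_dustE e B : no_dust e B = point_count (dust e) B @^-1` [set 0%N].
Proof.
apply/seteqP; split=> w; rewrite /no_dust /= /point_count.
  by move=> ->; rewrite fset_set0 cardfs0.
move=> /eqP; rewrite cardfs_eq0 => /eqP; apply: fset_set_set0.
by apply: finite_setIl; exact: (finD w e).1.
Qed.

Lemma process_sigma_algebra_count e B (U : set nat) : measurable B ->
  F e (point_count (dust e) B @^-1` U).
Proof.
move=> mB; apply: sub_sigma_algebra; exists B => //.
by exists U => //; rewrite setTI.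
Qed.

Lemma process_sigma_algebra_measurable e : F e `<=` measurable.
Proof.
apply: smallest_sub; first exact: sigma_algebra_measurable.
move=> A [B mB [U _ <-]]; have [_ mc _ _] := Pdust.1 e.
exact: mc.
Qed.

Lemma no_dust_sigma e B : measurable B -> F e (no_dust e B).
Proof. by move=> mB; rewrite no_dustE; exact: process_sigma_algebra_count. Qed.

Lemma no_dustC_sigma e B : measurable B -> F e (~` no_dust e B).
Proof.
move=> mB; rewrite no_dustE preimage_setC.
exact: process_sigma_algebra_count.
Qed.

Lemma measurable_no_dust e B : measurable B -> measurable (no_dust e B).
Proof.
move=> mB; apply: (@process_sigma_algebra_measurable e).
exact: no_dust_sigma.
Qed.

Lemma prob_no_dust e B : measurable B -> B `<=` `[0, 1] ->
  P (no_dust e B) = (expR (- (lambda * fine (lebesgue_measure B))))%:E.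
Proof.
move=> mB B01; have [_ _ pB _] := Pdust.1 e.
rewrite no_dustE pB//; set r := lambda * _.
have r0 : 0 <= r by rewrite mulr_ge0 ?fine_ge0// ltW.
rewrite /poisson_prob; case: ifPn => [rgt0|].
  rewrite esum_set1 ?lee_fin ?poisson_pmf_ge0// /poisson_pmf rgt0.
  by rewrite expr0 fact0 invr1 !mul1r.
rewrite lt_neqAle r0 andbT negbK => /eqP <-.
by rewrite oppr0 expR0 diracE mem_set.
Qed.

Lemma pr_no_dust_itv e (s t : R) : 0 <= s -> s < t -> t <= 1 ->
  pr (no_dust e `[s, t]) = expR (- (lambda * (t - s))).
Proof.
move=> s0 st t1; rewrite /pr prob_no_dust//=.
  by rewrite lebesgue_measure_itv /= lte_fin st -EFinD.
move=> u /=; rewrite !in_itv /= => /andP[su ut].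
by rewrite (le_trans ut)// andbT (le_trans s0).
Qed.

Definition edge_open e := no_dust e `[0, 1].

Definition alt_event : set Omega :=
  [set w | reach (fun e => edge_open e w /\ e != e0) 0 (delta_mx 0 i0)].

Lemma pr_edge_open e : pr (edge_open e) = expR (- lambda).
Proof. by rewrite /edge_open pr_no_dust_itv ?lexx// subr0 mulr1. Qed.

Local Notation alt_seq_event s :=
  [set w | alt_connected i0 (open_seq edge_open w s [::])].

Lemma edge_open_sigma e : F e (edge_open e) /\ F e (~` edge_open e).
Proof. by split; [exact: no_dust_sigma|exact: no_dustC_sigma]. Qed.

Lemma alt_seq_event_sub s : alt_seq_event s `<=` alt_event.
Proof.
move=> w /= /asboolP; apply: sub_reach => e [+ ee0].
by rewrite mem_open_seq /= => /andP[_ /set_mem].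
Qed.

Lemma measurable_alt_seq_event s : measurable (alt_seq_event s).
Proof.
exact: (measurable_open_seq process_sigma_algebra_measurable edge_open_sigma).
Qed.

Definition edge_prefix n : seq (edge d) :=
  [seq e <- pmap pickle_inv (iota 0 n) | e != e0].

Lemma edge_prefix_uniq n : uniq (edge_prefix n).
Proof.
by apply/filter_uniq/(pmap_uniq (@pickle_invK (edge d)))/iota_uniq.
Qed.

Lemma mem_edge_prefix n e :
  (e \in edge_prefix n) = (e != e0) && (choice.pickle e < n)%N.
Proof.
rewrite mem_filter mem_pmap; congr (_ && _); apply/mapP/idP.
  move=> [m]; rewrite mem_iota /= add0n => mn /esym em.
  by have := @pickle_invK (edge d) m; rewrite em /= => ->.
by move=> en; exists (choice.pickle e); rewrite ?mem_iota// pickleK_inv.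
Qed.

Lemma alt_eventE : alt_event = \bigcup_n alt_seq_event (edge_prefix n).
Proof.
apply/seteqP; split; last by move=> w [n _]; exact: alt_seq_event_sub.
move=> w /= /reach_finite[s [sO sr]].
exists (\max_(e <- s) (choice.pickle e).+1)%N => //=.
apply/asboolP; apply: sub_reach sr => e es; have [eO ee0] := sO _ es.
split=> //; rewrite mem_open_seq /= mem_edge_prefix ee0 mem_set// andbT.
exact: (@leq_bigmax_seq _ _ xpredT (fun e => (choice.pickle e).+1)).
Qed.

Lemma measurable_alt_event : measurable alt_event.
Proof.
by rewrite alt_eventE; apply: bigcup_measurable => n _;
  exact: measurable_alt_seq_event.
Qed.

Lemma cvg_pr_alt X : measurable X ->
  (fun n => pr (X `&` alt_seq_event (edge_prefix n))) @ \oo -->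
  pr (X `&` alt_event).
Proof.
move=> mX.
have mXs n : measurable (X `&` alt_seq_event (edge_prefix n)).
  by apply: measurableI => //; exact: measurable_alt_seq_event.
have XE : X `&` alt_event =
    \bigcup_n (X `&` alt_seq_event (edge_prefix n)).
  by rewrite alt_eventE setI_bigcupr.
apply: fine_cvg; rewrite -prE; last first.
  by apply: measurableI => //; exact: measurable_alt_event.
rewrite XE; apply: nondecreasing_cvg_mu => //; first exact: bigcup_measurable.
move=> m n mn; apply/subsetPset; apply: setIS => w /=.
apply: alt_connected_mono => e; rewrite !mem_open_seq /= !mem_edge_prefix.
by move=> /andP[/andP[-> em] ->]; rewrite (leq_trans em).
Qed.

Local Notation q s :=
  (perc_ex (expR (- lambda)) (fun b => (alt_connected i0 b)%:R) s [::]).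

Lemma pr_alt_seq_event s X : uniq s -> cylinder_off F s X ->
  pr (X `&` alt_seq_event s) = pr X * q s.
Proof.
exact: (pr_open_seq Pdust.2 process_sigma_algebra_measurable edge_open_sigma
  pr_edge_open).
Qed.

Lemma pr_setI_alt_event X : F e0 X ->
  pr (X `&` alt_event) = pr X * pr alt_event.
Proof.
move=> FX; have mX := process_sigma_algebra_measurable FX.
have cX n : cylinder_off F (edge_prefix n) X.
  have ce : cylinder_off F (e0 :: edge_prefix n) setT.
    exact: cylinder_off_setT.
  have [|] := cylinder_off_setI Pdust.2 process_sigma_algebra_measurable
    _ ce FX.
    by rewrite mem_edge_prefix eqxx.
  by rewrite setTI.
have := cvg_pr_alt measurableT; rewrite setTI => c1.
have E : (fun n => pr (X `&` alt_seq_event (edge_prefix n))) =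
    (fun n => pr X * pr (setT `&` alt_seq_event (edge_prefix n))).
  apply/funext => n.
  rewrite !pr_alt_seq_event ?edge_prefix_uniq//; last exact: cylinder_off_setT.
  by rewrite pr_setT mul1r.
apply: (cvg_unique (@Rhausdorff R) (cvg_pr_alt mX)).
by rewrite E; exact: cvgMl_tmp c1.
Qed.

Lemma le_pr_alt_event s : uniq s -> q s <= pr alt_event.
Proof.
move=> us; have := pr_alt_seq_event us (cylinder_off_setT F s).
rewrite setTI pr_setT mul1r => <-.
apply: pr_le; last exact: alt_seq_event_sub.
- exact: measurable_alt_seq_event.
- exact: measurable_alt_event.
Qed.

Lemma pr_alt_event_le x : (forall s, uniq s -> q s <= x) -> pr alt_event <= x.
Proof.
move=> qx; have := cvg_pr_alt measurableT; rewrite setTI => c1.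
apply: (cvgr_to_le c1); near=> n.
rewrite pr_alt_seq_event ?edge_prefix_uniq//; last exact: cylinder_off_setT.
by rewrite pr_setT mul1r qx// edge_prefix_uniq.
Unshelve. all: by end_near. Qed.

End PipeDustEvents.

(** * Connection probabilities *)

Section ConnectionProbability.
Context {R : realType} {d : nat} (i0 : 'I_d).
Context {disp : measure_display} {Omega : measurableType disp}.
Variables (P : probability Omega R) (lambda : R).
Variable dust : edge d -> Omega -> set R.
Hypothesis lambda_gt0 : 0 < lambda.
Hypothesis Pdust : pipe_dust P lambda dust.
Hypothesis i0_eq0 : i0 = 0%N :> nat.
Implicit Types (e : edge d) (B : set R) (w : Omega).

Local Notation pr := (pr P).
Local Notation q := (pr (alt_event i0 dust)).
Let e0 := base_edge i0.

Let finD w e : finite_set (dust e w) /\ dust e w `<=` `[0, 1].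
Proof. by have [+ _ _ _] := Pdust.1 e; apply. Qed.

Definition clear_event e (s t : R) : set Omega :=
  [set w | clear_segment (dust ^~ w) e s t].

(* Dust at a vertex may come from any incident edge, so every edge [e'] is
   tested on the closed set of its parameters that lie in the segment. *)
Lemma measurable_clear_event e s t : 0 <= s -> t <= 1 ->
  measurable (clear_event e s t).
Proof.
move=> s0 t1.
have -> : clear_event e s t = ~` \bigcup_e' ~` no_dust dust e'
    (edge_point e' @^-1` (edge_point e @` `[s, t])).
  rewrite setC_bigcup; apply/seteqP; split=> w cl.
    move=> e' _; rewrite setCK /no_dust /= -subset0 => u' [du' [u]].
    rewrite /= in_itv /= => /cl nd eu; apply: nd; exists e' => //.
    by exists u'; rewrite ?eu.
  move=> u su [e' _ [u' du' eu]]; have := cl e' I; rewrite setCK.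
  rewrite /no_dust /= -subset0 => /(_ u'); apply; split=> //.
  by exists u; rewrite ?eu //= in_itv.
apply/measurableC/countable_bigcupT_measurable; first exact: countableP.
move=> e'; apply: measurableC; apply: (measurable_no_dust Pdust).
apply: closed_measurable; apply: preimage_closed.
  by move=> ? _; exact: edge_point_continuous.
apply: closed_edge_point_image; first exact: itv_closed.
move=> u /=; rewrite !in_itv /= => /andP[su ut].
by rewrite (le_trans s0 su) (le_trans ut t1).
Qed.

Definition clear_reach_event : set Omega :=
  [set w | reach (fun e => clear_segment (dust ^~ w) e 0 1) 0 (delta_mx 0 i0)].

Lemma measurable_clear_reach_event : measurable clear_reach_event.
Proof.
have -> : clear_reach_event = \bigcup_(s : seq (edge d))
    if `[< reach (fun e => e \in s) 0 (delta_mx 0 i0 : 'rV[int]_d) >]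
    then \bigcap_(e in [set` s]) clear_event e 0 1 else set0.
  apply/seteqP; split=> w.
    move=> /reach_finite[s [sO sr]]; exists s => //.
    by rewrite (asboolT sr) => e; exact: sO.
  move=> [s _]; case: asboolP => // sr sw.
  by apply: sub_reach sr => e; exact: sw.
apply: countable_bigcupT_measurable; first exact: countableP.
move=> s; case: ifP => // _; apply: fin_bigcap_measurable => // e _.
exact: measurable_clear_event.
Qed.

Section FixedTime.
Variable t : R.
Hypothesis t01 : 0 < t < 1.

Let generic_dust w := forall e, no_dust dust e [set 0; 1; t] w.

Lemma clear_segment_no_dust w e (a b : R) :
  generic_dust w -> 0 <= a -> b <= 1 ->
  clear_segment (dust ^~ w) e a b <-> no_dust dust e `[a, b] w.
Proof.
move=> sd a0 b1; split=> [cl|nd u uab [e' _ [u' du' eu]]].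
  rewrite /no_dust /= -subset0 => u [du /=]; rewrite in_itv /= => /cl; apply.
  by exists e => //; exists u.
have nu' c : [set 0; 1; t] c -> u' != c.
  move=> hc; apply/eqP => u'c; have := sd e'; rewrite /no_dust /= -subset0.
  by apply; split; [exact: du'|rewrite u'c; exact: hc].
have u'01 := (finD w e').2 _ du'; rewrite /= in_itv /= in u'01.
have u'int : 0 < u' < 1.
  have /andP[u'0 u'1] := u'01.
  have h0 : u' != 0 by apply: nu'; left; left.
  have h1 : u' != 1 by apply: nu'; left; right.
  by rewrite !lt_neqAle u'0 u'1 eq_sym h0 h1.
have uu' : 0 <= u <= 1.
  by case/andP: uab => au ub; rewrite (le_trans a0 au) (le_trans ub b1).
have [ee uE] := edge_point_inj u'int uu' eu; subst e' u'.
by move: nd; rewrite /no_dust /= -subset0 => /(_ u); apply; rewrite /= in_itv.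
Qed.

Lemma nongeneric_dust_negligible : P.-negligible (~` generic_dust).
Proof.
have m3 : measurable ([set 0; 1; t] : set R).
  by apply: measurableU => //; exact: measurableU.
have sub : [set 0; 1; t] `<=` (`[0, 1] : set R).
  move=> u /= [[->|->]|->]; rewrite in_itv /= ?lexx ?ler01//.
  by case/andP: t01 => t0 t1; rewrite !ltW.
have l0 : lebesgue_measure ([set 0; 1; t] : set R) = 0%E.
  by apply: countable_lebesgue_measure0; apply: finite_set_countable.
apply: (@negligibleS _ _ _ P (\bigcup_n
    if @pickle_inv (edge d) n is Some e then ~` no_dust dust e [set 0; 1; t]
    else set0)).
  move=> w /existsNP[e h]; exists (choice.pickle e) => //.
  by rewrite pickleK_inv.
apply: negligible_bigcup => n; case: (pickle_inv n) => [e|]; last first.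
  exact: negligible_set0.
exists (~` no_dust dust e [set 0; 1; t]); split=> //.
  exact/measurableC/(measurable_no_dust Pdust).
apply: etrans (probability_setC P (measurable_no_dust Pdust e m3)) _.
by rewrite (prob_no_dust lambda_gt0 Pdust)// l0 /= mulr0 oppr0 expR0 subee.
Qed.

Let U := no_dust dust e0 `[0, t].
Let V := no_dust dust e0 `[t, 1].
Let O := edge_open dust e0.

Let mU : measurable U.
Proof. exact: (measurable_no_dust Pdust e0 (measurable_itv _)). Qed.
Let mV : measurable V.
Proof. exact: (measurable_no_dust Pdust e0 (measurable_itv _)). Qed.
Let mO : measurable O.
Proof. exact: (measurable_no_dust Pdust e0 (measurable_itv _)). Qed.
Let mQ : measurable (alt_event i0 dust).
Proof. exact: (measurable_alt_event i0 Pdust). Qed.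

Let UV : U `&` V = O.
Proof.
rewrite /U /V /O /edge_open /no_dust; apply/seteqP; split=> w /=.
  rewrite -!subset0 => -[u v] s [ds]; rewrite /= in_itv /= => /andP[s0 s1].
  have [st|ts] := leP s t.
    by apply: (u s); split=> //=; rewrite in_itv /= s0.
  by apply: (v s); split=> //=; rewrite in_itv /= s1 ltW.
case/andP: t01 => t0 t1.
rewrite -!subset0 => h; split=> s [ds]; rewrite /= in_itv /= => /andP[h1 h2];
  apply: (h s); split=> //=; rewrite in_itv /=.
- by rewrite h1 (le_trans h2) ?ltW.
- by rewrite h2 (le_trans _ h1) ?ltW.
Qed.

Lemma clear_reach_off_null w : generic_dust w ->
  clear_reach_event w <-> (O `|` alt_event i0 dust) w.
Proof.
move=> sd; have cle e : clear_segment (dust ^~ w) e 0 1 <-> edge_open dust e w.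
  by apply: clear_segment_no_dust.
split.
  move=> r; have [wO|wO] := pselect (O w); first by left.
  right; apply: sub_reach r => e /cle eo; split=> //.
  by apply/eqP => ee0; apply: wO; rewrite /O /e0 -ee0.
case=> [Ow|]; last by apply: sub_reach => e [/cle].
rewrite /clear_reach_event /= -[delta_mx 0 i0]add0r.
by apply: reach_forward; [exact: reach_refl|apply/cle].
Qed.

Lemma pr_clear_reach_event :
  pr clear_reach_event = expR (- lambda) + (1 - expR (- lambda)) * q.
Proof.
rewrite (@pr_eq_off_null _ _ _ _ _ (O `|` alt_event i0 dust) (~` generic_dust)).
- have sO := (edge_open_sigma Pdust e0).1.
  rewrite pr_setU// (pr_setI_alt_event lambda_gt0 Pdust sO).
  by rewrite (pr_edge_open lambda_gt0 Pdust); ring.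
- exact: measurable_clear_reach_event.
- exact: measurableU.
- exact: nongeneric_dust_negligible.
- apply/seteqP; split=> w /= [h /contrapT sd]; split=> //.
  + by apply/clear_reach_off_null.
  + by apply/clear_reach_off_null.
Qed.

Definition interior_event : set Omega :=
  clear_event e0 0 t `|` (clear_event e0 t 1 `&` clear_reach_event).

Lemma measurable_interior_event : measurable interior_event.
Proof.
case/andP: t01 => t0 t1; apply: measurableU.
  by apply: measurable_clear_event => //; exact: ltW.
apply: measurableI; last exact: measurable_clear_reach_event.
by apply: measurable_clear_event => //; exact: ltW.
Qed.

Lemma pr_interior_event : pr interior_event = expR (- (lambda * t)) +
  (expR (- (lambda * (1 - t))) - expR (- lambda)) * q.
Proof.
case/andP: (t01) => t0 t1.
rewrite (@pr_eq_off_null _ _ _ _ _ (U `|` (V `&` alt_event i0 dust))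
  (~` generic_dust)).
- rewrite pr_setU//; last exact: measurableI.
  have sV := no_dust_sigma Pdust (e := e0) (measurable_itv `[t, 1]).
  have sO := (edge_open_sigma Pdust e0).1.
  rewrite setIA UV (pr_setI_alt_event lambda_gt0 Pdust sV).
  rewrite (pr_setI_alt_event lambda_gt0 Pdust sO).
  rewrite (pr_edge_open lambda_gt0 Pdust).
  rewrite /U /V !(pr_no_dust_itv lambda_gt0 Pdust) ?lexx ?ltW// subr0; ring.
- exact: measurable_interior_event.
- by apply: measurableU => //; exact: measurableI.
- exact: nongeneric_dust_negligible.
- apply/seteqP; split=> w /= [h /contrapT sd]; split=> //; case: h.
  + by move=> /(clear_segment_no_dust _ sd (lexx 0) (ltW t1)) ?; left.
  + move=> [/(clear_segment_no_dust _ sd (ltW t0) (lexx 1)) Vw].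
    move=> /(clear_reach_off_null sd).
    by case=> [Ow|Qw]; [left; move: Ow; rewrite -UV => -[]|right].
  + by move=> /(clear_segment_no_dust _ sd (lexx 0) (ltW t1)) ?; left.
  + move=> [/(clear_segment_no_dust _ sd (ltW t0) (lexx 1)) Vw Qw].
    right; split=> //.
    by apply/(clear_reach_off_null sd); right.
Qed.

Lemma first_basis_vectorE : first_basis_vector R d = vertex (delta_mx 0 i0).
Proof.
apply/matrixP => i j; rewrite ord1 !mxE eqxx /=.
by rewrite -(inj_eq val_inj) /= i0_eq0; case: eqP.
Qed.

Let vertex0E : (0 : 'rV[R]_d) = vertex 0.
Proof. by apply/matrixP => i j; rewrite !mxE. Qed.

Lemma pipes_vertex0 : pipes (vertex 0 : 'rV[R]_d).
Proof.
exists e0 => //; exists 0; last by rewrite edge_point0.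
by rewrite /= in_itv /= lexx ler01.
Qed.

Lemma clear_reach_no_dust w : clear_reach_event w ->
  ~ dust_points (dust ^~ w) (vertex 0).
Proof.
move=> /reach_first_edge; case; first exact: delta_mx_neq0.
move=> e; rewrite mem_cat => /orP[] /mapP[i _ ->] cl.
- by rewrite -(edge_point0 (0, i)); apply: cl; rewrite lexx ler01.
- rewrite -[X in vertex X](subrK (delta_mx 0 i)).
  rewrite -(edge_point1 (0 - delta_mx 0 i, i)).
  by apply: cl; rewrite lexx ler01.
Qed.

Lemma connection_event_vertex :
  connection_event dust 0 (first_basis_vector R d) = clear_reach_event.
Proof.
rewrite first_basis_vectorE vertex0E; apply/seteqP; split=> w.
- move=> /(dust_connectedP (finD w) _ pipes_vertex0)[_ /linked_vertex]; apply.
  by rewrite eq_sym delta_mx_neq0.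
- move=> r; apply/(dust_connectedP (finD w) _ pipes_vertex0).
  split; first exact: clear_reach_no_dust.
  by apply/linked_vertex => //; rewrite eq_sym delta_mx_neq0.
Qed.

Lemma connection_event_interior :
  connection_event dust 0 (t *: first_basis_vector R d) = interior_event.
Proof.
have -> : t *: first_basis_vector R d = edge_point e0 t.
  rewrite first_basis_vectorE; apply/matrixP => i j.
  by rewrite ord1 edge_pointE !mxE eqxx /= add0r; case: (j == i0).
rewrite vertex0E; apply/seteqP; split=> w.
- move=> /(dust_connectedP (finD w) _ pipes_vertex0)[_].
  by move=> /(linked_interior _ _ t01).
- move=> h; apply/(dust_connectedP (finD w) _ pipes_vertex0).
  split; last exact/linked_interior.
  case: h => [cl|[_]]; last exact: clear_reach_no_dust.
  rewrite -(edge_point0 e0); apply: cl; rewrite lexx ltW//.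
  by case/andP: t01.
Qed.

Lemma connection_probabilities :
  P (connection_event dust 0 (first_basis_vector R d)) =
    (expR (- lambda) + (1 - expR (- lambda)) * q)%:E /\
  P (connection_event dust 0 (t *: first_basis_vector R d)) =
    (expR (- (lambda * t)) +
     (expR (- (lambda * (1 - t))) - expR (- lambda)) * q)%:E.
Proof.
rewrite connection_event_vertex connection_event_interior.
rewrite -pr_clear_reach_event -pr_interior_event; split; apply: prE.
- exact: measurable_clear_reach_event.
- exact: measurable_interior_event.
Qed.


End FixedTime.
End ConnectionProbability.

Lemma connection_prob_diff (R : realType) (lambda t q : R) :
  expR (- (lambda * t)) +
    (expR (- (lambda * (1 - t))) - expR (- lambda)) * q -
    (expR (- lambda) + (1 - expR (- lambda)) * q) =
  (1 - expR (- (lambda * (1 - t)))) * (expR (- (lambda * t)) - q).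
Proof.
have -> : expR (- lambda) = expR (- (lambda * t)) * expR (- (lambda * (1 - t))).
  by rewrite -expRD; congr expR; ring.
by ring.
Qed.

Theorem theorem2 (R : realType) (d : nat) (hd : (2 <= d)%N) :
  exists lambda_c : R,
    [/\ 0 < lambda_c,
        forall lambda : R, lambda_c < lambda ->
        forall t : R, 0 < t < 1 ->
        forall (disp : measure_display) (Omega : measurableType disp)
          (P : probability Omega R) (dust : edge d -> Omega -> set R),
        pipe_dust P lambda dust ->
          (P (connection_event dust 0 (first_basis_vector R d)) <
           P (connection_event dust 0 (t *: first_basis_vector R d)))%E
      & forall lambda : R, 0 < lambda < lambda_c ->
        exists t : R, 0 < t < 1 /\
        forall (disp : measure_display) (Omega : measurableType disp)
          (P : probability Omega R) (dust : edge d -> Omega -> set R),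
        pipe_dust P lambda dust ->
          (P (connection_event dust 0 (first_basis_vector R d)) >
           P (connection_event dust 0 (t *: first_basis_vector R d)))%E].
Proof.
have d0 : (0 < d)%N by exact: ltnW.
pose i0 := Ordinal d0; pose i1 := Ordinal hd.
have [pc /andP[pc0 pc1] [low high]] :=
  @critical_parameter R d i0 i1 isT.
exists (- ln pc); split.
- by rewrite oppr_gt0 ln_lt0// pc0.
- move=> lambda lc t t01 disp Omega P dust Pdust.
  have l0 : 0 < lambda by apply: lt_trans lc; rewrite oppr_gt0 ln_lt0// pc0.
  have [-> ->] :=
    connection_probabilities l0 Pdust (erefl : i0 = 0%N :> nat) t01.
  have /andP[t0 t1] := t01.
  rewrite lte_fin -subr_gt0 connection_prob_diff mulr_gt0//.
    by rewrite subr_gt0 expR_lt1 oppr_lt0 mulr_gt0// subr_gt0.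
  rewrite subr_gt0; apply: (@le_lt_trans _ _ (expR (- lambda))).
    apply: (pr_alt_event_le l0 Pdust); apply: low.
    by rewrite expR_gt0 -[X in _ < X](lnK pc0) ltr_expR ltrNl.
  by rewrite ltr_expR ltrN2 gtr_pMr.
- move=> lambda /andP[l0 lc].
  set p := expR (- lambda).
  have p0 : 0 < p := expR_gt0 _.
  have p1 : p < 1 by rewrite expR_lt1 oppr_lt0.
  have [|s us pq] := high p.
    by rewrite p1 andbT -[X in X < _](lnK pc0) ltr_expR ltrNr.
  set qs := perc_ex _ _ _ _ in pq.
  have qs1 : qs <= 1.
    apply: perc_ex_le1; first by rewrite !ltW.
    by move=> b; rewrite lern1 leq_b1.
  pose x := (p + qs) / 2.
  have px : p < x by rewrite /x; lra.
  have xq : x < qs by rewrite /x; lra.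
  have x0 : 0 < x by lra.
  have x1 : x < 1 by lra.
  pose t := - ln x / lambda.
  have lt : lambda * t = - ln x by rewrite /t mulrC divfK// gt_eqF.
  have t01 : 0 < t < 1.
    rewrite /t divr_gt0 ?oppr_gt0 ?ln_lt0 ?x0//=.
    by rewrite ltr_pdivrMr// mul1r ltrNl -ltr_expR lnK.
  exists t; split=> // disp Omega P dust Pdust.
  have [-> ->] :=
    connection_probabilities l0 Pdust (erefl : i0 = 0%N :> nat) t01.
  have qs_le : qs <= pr P (alt_event i0 dust) by exact: le_pr_alt_event.
  rewrite lte_fin -subr_lt0 connection_prob_diff pmulr_rlt0.
    by rewrite lt opprK lnK// subr_lt0 (lt_le_trans xq).
  case/andP: t01 => _ ?.
  by rewrite subr_gt0 expR_lt1 oppr_lt0 mulr_gt0// subr_gt0.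
Qed.
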